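(* Let $\mathcal{I}$ be a nontrivial admissible ideal of subsets of $\mathbb{N}$, and let $\mathcal{T}^{\mathcal{I}}=\{A\in\mathcal{L}: A\subseteq\Theta_{\mathcal{I}}(A)\}$ be the $\mathcal{I}$-density topology on $\mathbb{R}$. The Borel sets of $\mathcal{T}^{\mathcal{I}}$ are precisely the Lebesgue measurable subsets of $\mathbb{R}$; that is, the smallest $\sigma$-algebra on $\mathbb{R}$ containing $\mathcal{T}^{\mathcal{I}}$ equals $\mathcal{L}$.
   Context: Let $\mathcal{L}$ be the $\sigma$-algebra of Lebesgue measurable subsets of $\mathbb{R}$ and $\lambda$ the Lebesgue measure. A family $\mathcal{I}\subseteq 2^{\mathbb{N}}$ is an ideal if it is closed under finite unions and under taking subsets; it is nontrivial if $\mathcal{I}\neq\{\emptyset\}$ and $\mathbb{N}\notin\mathcal{I}$; it is admissible if it contains all singletons. The associated filter is $\mathcal{F}(\mathcal{I})=\{M\subseteq\mathbb{N}:\mathbb{N}\setminus M\in\mathcal{I}\}$. For a real sequence $x=\{x_n\}_{n\in\mathbb{N}}$ put $A_x=\{a\in\mathbb{R}:\{k:x_k<a\}\notin\mathcal{I}\}$; then $\mathcal{I}\text{-}\liminf x=\inf A_x$ if $A_x\neq\emptyset$, and $\mathcal{I}\text{-}\liminf x=\infty$ if $A_x=\emptyset$. A sequence of closed intervals $\{J_n\}_{n\in\mathbb{N}}$ is about a point $p$ if $p\in\bigcap_n J_n$. Put $\mathscr{S}(J_n)=\{n\in\mathbb{N}:0<\lambda(J_n)<\frac1n\}$. For $E\in\mathcal{L}$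 and $p\in\mathbb{R}$ the lower $\mathcal{I}$-density of $E$ at $p$ is $$\mathcal{I}\text{-}d_-(p,E)=\inf\left\{\mathcal{I}\text{-}\liminf \frac{\lambda(J_n\cap E)}{\lambda(J_n)}\right\},$$ the infimum being over all sequences $\{J_n\}_{n\in\mathbb{N}}$ of closed intervals about $p$ with $\mathscr{S}(J_n)\in\mathcal{F}(\mathcal{I})$ (the values of the quotient for $n\notin\mathscr{S}(J_n)$, even if undefined, do not affect the $\mathcal{I}$-limit inferior and may be assigned arbitrarily). For $E\in\mathcal{L}$, $\Theta_{\mathcal{I}}(E)=\{x\in\mathbb{R}:\mathcal{I}\text{-}d_-(x,E)=1\}$. The collection of Borel sets of a topology is the smallest $\sigma$-algebra containing its open sets. *)

(* Defs.v *)
From HB Require Import structures.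
From mathcomp Require Import all_boot all_order all_algebra.
From mathcomp Require Import all_classical all_reals all_analysis.
Set Implicit Arguments.
Unset Strict Implicit.
Unset Printing Implicit Defensive.
Import Order.TTheory GRing.Theory Num.Theory.
Import numFieldNormedType.Exports.
Local Open Scope classical_set_scope.
Local Open Scope ring_scope.

(* Sequences are indexed by [nat], and the index [n : nat] stands for the
   positive integer [n.+1]; hence the bound 1/n becomes [n.+1%:R^-1]. *)

Definition is_ideal (I : set (set nat)) : Prop :=
  (forall A B, I A -> I B -> I (A `|` B)) /\
  (forall A B, A `<=` B -> I B -> I A).

Definition nontrivial_ideal (I : set (set nat)) : Prop :=
  I <> [set set0] /\ ~ I setT.

Definition admissible_ideal (I : set (set nat)) : Prop :=
  forall n : nat, I [set n].

Definition ideal_filter (I : set (set nat)) : set (set nat) :=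
  [set M | I (~` M)].

(* The case of an empty set is covered by [ereal_inf set0 = +oo]. *)
Definition ideal_liminf (R : realType) (I : set (set nat)) (x : nat -> R) :
    \bar R :=
  ereal_inf (EFin @` [set a : R | ~ I [set k | x k < a]]).

(* The Lebesgue measurable (not merely Borel) sets: the Caratheodory measurable
   sets of the outer measure induced by interval length, which form the domain
   of [completed_lebesgue_measure]. *)
Definition lebesgue_measurable (R : realType) : set (set R) :=
  ((@wlength R idfun)^*)%mu.-cara.-measurable.

Definition closed_intervals_about (R : realType) (p : R) (J : nat -> set R) :
    Prop :=
  (forall n, exists a b : R, a <= b /\ J n = `[a, b]%classic) /\
  (\bigcap_n J n) p.

Definition small_indices (R : realType) (J : nat -> set R) : set nat :=
  [set n | (0 < completed_lebesgue_measure (J n) < (n.+1%:R^-1)%:E)%E].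

(* Equal to 0 when [J n] is a null set. *)
Definition density_quotient (R : realType) (E : set R) (J : nat -> set R)
    (n : nat) : R :=
  fine (completed_lebesgue_measure (J n `&` E)) /
  fine (completed_lebesgue_measure (J n)).

Definition lower_ideal_density (R : realType) (I : set (set nat)) (p : R)
    (E : set R) : \bar R :=
  ereal_inf [set ideal_liminf I (density_quotient E J) | J in
    [set J | closed_intervals_about p J /\
             ideal_filter I (small_indices J)]].

Definition ideal_density_points (R : realType) (I : set (set nat))
    (E : set R) : set R :=
  [set x | lower_ideal_density I x E = 1%E].

Definition ideal_density_topology (R : realType) (I : set (set nat)) :
    set (set R) :=
  [set A | lebesgue_measurable A /\ A `<=` ideal_density_points I A].

(* Main.v *)
(* Call [x] a density point of [E] if the intervals around [x] are almost filled
   by [E] as soon as they are short. For a sequence of intervals whose small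
   indices belong to the filter of [I], the quotients at a density point exceed
   [1 - e] outside a set in [I]: the non-small indices together with finitely
   many others. Hence density points lie in Theta_I(E). By Lebesgue's density
   theorem a measurable [E] has a null set [Z] such that every point of
   [E `\` Z] is a density point of [E `\` Z], so [E `\` Z] is open, while
   [E `&` Z] is null and therefore the complement of an open set. *)
Require Import Defs.
From HB Require Import structures.
From mathcomp Require Import all_boot all_order all_algebra.
From mathcomp Require Import all_classical all_reals all_analysis.
From mathcomp Require Import measurable_realfun lra.
Local Open Scope classical_set_scope.
Import Order.TTheory GRing.Theory Num.Theory.
Import numFieldNormedType.Exports.

Section interval_density.
Local Open Scope ring_scope.
Context {R : realType}.
Local Notation leb := (@completed_lebesgue_measure R).

Lemma le_completed_lebesgue (A B : set R) : A `<=` B -> (leb A <= leb B)%E.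
Proof. exact: (le_outer_measure (wlength idfun)^*%mu). Qed.

Lemma completed_lebesgueU2 (A B : set R) :
  (leb (A `|` B) <= leb A + leb B)%E.
Proof. exact: (outer_measureU2 (wlength idfun)^*%mu). Qed.

Lemma completed_lebesgue_ge0 (A : set R) : (0 <= leb A)%E.
Proof. exact: (outer_measure_ge0 (wlength idfun)^*%mu). Qed.

Lemma completed_lebesgue_itv (a b : R) : a <= b ->
  leb `[a, b]%classic = (b - a)%:E.
Proof.
(* Both measures are the same outer measure, so the known length transfers by conversion. *)
move=> ab; transitivity (lebesgue_measure (`[a, b]%classic : set R)) => //.
rewrite lebesgue_measure_itv/= lte_fin; case: ltP => [//|ba].
by rewrite (@le_anti _ _ a b) ?ab// subrr.
Qed.

Lemma completed_lebesgue_setI_itv (a b : R) (E : set R) : a <= b ->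
  0 <= fine (leb (`[a, b]%classic `&` E)) <= b - a /\
  leb (`[a, b]%classic `&` E) \is a fin_num.
Proof.
move=> ab.
have le : (leb (`[a, b]%classic `&` E) <= (b - a)%:E)%E.
  by rewrite -completed_lebesgue_itv//; apply: le_completed_lebesgue; exact: subIsetl.
have ge0 : (0 <= leb (`[a, b]%classic `&` E))%E by exact: completed_lebesgue_ge0.
have fin : leb (`[a, b]%classic `&` E) \is a fin_num.
  by rewrite ge0_fin_numE// (le_lt_trans le)// ltry.
by split => //; rewrite -!lee_fin fineK// ge0 le.
Qed.

(* One-sided form of "the metric density of [E] at [x] is 1", over all the
   closed intervals containing [x], not only those centered at [x]. *)
Definition interval_density_one (E : set R) (x : R) : Prop :=
  forall e, 0 < e -> exists2 d, 0 < d & forall a b, a < b -> a <= x <= b ->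
    b - a < d -> (((1 - e) * (b - a))%:E <= leb (`[a, b]%classic `&` E))%E.

Lemma interval_density_one_setT (x : R) : interval_density_one setT x.
Proof.
move=> e e0; exists 1 => // a b ab _ _.
rewrite setIT completed_lebesgue_itv ?(ltW ab)// lee_fin; nra.
Qed.

(** By subadditivity, deleting a null set lowers the measure of [E] in no interval, so the same [d]
    serves. *)
Lemma interval_density_oneD (E Z : set R) (x : R) : leb Z = 0%E ->
  interval_density_one E x -> interval_density_one (E `\` Z) x.
Proof.
move=> Z0 + e e0 => /(_ e e0)[d d0 Ed]; exists d => // a b ab axb abd.
apply: (le_trans (Ed a b ab axb abd)).
rewrite -[leRHS]adde0 -Z0; apply: le_trans (completed_lebesgueU2 _ _).
apply: le_completed_lebesgue => y [aby Ey].
by have [Zy|nZy] := pselect (Z y); [right|left].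
Qed.

(** Passage from centered balls to arbitrary intervals around [x]: the interval fills a quarter of
    the ball of radius [2 * (b - a)], so a relative deficit [e / 4] in the ball becomes at most [e]
    in the interval. *)
Lemma interval_density_one_ball (A : set R) (x : R) :
  (lebesgue_measure (A `&` ball x r) / lebesgue_measure (ball x r))%E
    @[r --> 0^'+] --> 1%E ->
  interval_density_one A x.
Proof.
move=> Ax e e0.
have : \forall r \near (0 : R)^'+,
    ((1 - e / 4)%:E < lebesgue_measure (A `&` ball x r) /
      lebesgue_measure (ball x r))%E.
  apply: (Ax [set y : \bar R | ((1 - e / 4)%:E < y)%E]).
  apply: open_nbhs_nbhs; split; first exact: open_ereal_gt_ereal.
  by rewrite /= lte_fin; lra.
rewrite near_withinE => /nbhs_ballP[d /= d0 xd].
exists (d / 4); first by lra.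
move=> a b ab /andP[ax xb] abd.
(* The ball is open: radius [b - a] would lose an endpoint when [x] is the other one. *)
set r := 2 * (b - a).
have r0 : 0 < r by rewrite /r; lra.
have r2 : 0 < r *+ 2 by rewrite mulrn_wgt0.
have {xd} : ((1 - e / 4)%:E < lebesgue_measure (A `&` ball x r) /
      lebesgue_measure (ball x r))%E.
  by apply: xd => //; rewrite /ball/= ltr_norml /r; lra.
rewrite lebesgue_measure_ball ?(ltW r0)// inver gt_eqF// lte_pdivlMr// -EFinM.
move=> lt.
have ab_ball : `[a, b]%classic `<=` ball x r.
  move=> y /=; rewrite in_itv/= /ball/= => /andP[ay yb].
  by rewrite ltr_norml /r; lra.
have : (leb (A `&` ball x r) <=
   leb (`[a, b]%classic `&` A) + leb (ball x r `\` `[a, b]%classic))%E.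
  apply: le_trans (completed_lebesgueU2 _ _); apply: le_completed_lebesgue.
  move=> y [Ay bally]; have [aby|] := pselect (`[a, b]%classic y); last by right.
  by left.
have -> : leb (ball x r `\` `[a, b]%classic) = (3 * (b - a))%:E.
  have : lebesgue_measure (ball x r `\` (`[a, b]%classic : set R)) =
      (3 * (b - a))%:E.
    rewrite measureD//=; last 2 first.
    - exact: measurable_ball.
    - by rewrite lebesgue_measure_ball ?(ltW r0)// ltry.
    rewrite setIidr// lebesgue_measure_ball ?(ltW r0)//.
    rewrite lebesgue_measure_itv/= lte_fin ab -!EFinB.
    by congr EFin; rewrite /r mulr2n; lra.
  by [].
have [_ fin] := @completed_lebesgue_setI_itv a b A (ltW ab).
move=> /(lt_le_trans lt); rewrite -(fineK fin) -EFinD lte_fin lee_fin.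
by rewrite /r mulr2n; lra.
Qed.

(** Lebesgue's density theorem is applied to a Borel set [A] that differs from [E] only inside a
    Borel null set [M]. Once [M] and the exceptional set [D] are deleted, [A] and [E] coincide. *)
Lemma interval_density_ae (E : set R) : lebesgue_measurable E ->
  exists Z : set R, [/\ lebesgue_measurable Z, leb Z = 0%E &
    forall x, (E `\` Z) x -> interval_density_one (E `\` Z) x].
Proof.
rewrite {1}/lebesgue_measurable -completed_caratheodory_measurable.
rewrite g_sigma_completed_algebra_genE => -[/= A mA [N [M [mM M0 NM]]] AN].
have [D [mD D0 AD]] := lebesgue_density mA.
pose Z : set R := M `|` D.
have mZ : measurable Z by exact: measurableU.
have Z0 : leb Z = 0%E.
  apply/eqP; rewrite eq_le completed_lebesgue_ge0 andbT.
  apply: le_trans (completed_lebesgueU2 _ _) _.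
  by rewrite [leb M]M0 [leb D]D0 adde0.
exists Z; split => //; first exact: sub_caratheodory.
have EA : E `\` Z `<=` A.
  by rewrite -AN => y [[|/NM My]// nZ]; case: nZ; left.
move=> x EZx; have Ax := EA x EZx.
have AZx : interval_density_one (A `\` Z) x.
  apply: interval_density_oneD => //; apply: interval_density_one_ball.
  have : ~ D x by move=> Dx; apply: EZx.2; right.
  (* Off [D] the density limit is the indicator of [A] at [x], here 1. *)
  by move=> /(contra_not (AD x)) /contrapT /=; rewrite indicE mem_set.
suff <- : (A : set R) `\` Z = E `\` Z by [].
rewrite -AN; apply/seteqP; split=> [y [Ay nZ]|y [[Ay|/NM My] nZ]].
- by split => //; left.
- by split.
- by exfalso; apply: nZ; left.
Qed.

End interval_density.

Section ideal_density.
Local Open Scope ring_scope.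
Context {R : realType} {I : set (set nat)}.
Hypothesis I_ideal : is_ideal I.
Hypothesis I_nontrivial : nontrivial_ideal I.
Hypothesis I_admissible : admissible_ideal I.
Local Notation leb := (@completed_lebesgue_measure R).

Lemma ideal_initial_segment n : I [set k | (k < n)%N].
Proof.
elim: n => [|n IHn].
  by apply: (I_ideal.2 _ [set 0%N]).
apply: (I_ideal.2 _ ([set k | (k < n)%N] `|` [set n])).
  move=> k /=; rewrite ltnS leq_eqVlt => /orP[/eqP ->|kn]; first by right.
  by left.
exact: I_ideal.1.
Qed.

(** Each [1 + e] competes in the infimum, since all indices satisfy [x n < 1 + e] and the full index
    set is not in [I]; no [a < 1] does, by the second hypothesis at [1 - a]. *)
Lemma ideal_liminf_eq1 (x : nat -> R) : (forall n, x n <= 1) ->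
  (forall e, 0 < e -> I [set n | x n < 1 - e]) -> ideal_liminf I x = 1%E.
Proof.
move=> x1 xI; apply/eqP; rewrite eq_le; apply/andP; split.
- apply/lee_addgt0Pr => e e0.
  apply: ereal_inf_lbound; exists (1 + e) => //= Ie.
  apply: I_nontrivial.2; apply: I_ideal.2 Ie => n _ /=.
  by have := x1 n; lra.
- apply: le_ereal_inf_tmp => _ [a /= aI <-]; rewrite lee_fin leNgt.
  apply/negP => a1; apply: aI.
  have := xI (1 - a); rewrite subKr; apply; lra.
Qed.

(** Keeps the infimum defining the density from ranging over the empty set, where it would be
    [+oo]. *)
Lemma closed_intervals_about_small (p : R) : exists J,
  closed_intervals_about p J /\ ideal_filter I (small_indices J).
Proof.
(* Smallness at [n] is a strict bound by [n.+1%:R^-1], hence [n.+2]. *)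
exists (fun n => `[p, p + n.+2%:R^-1]%classic).
have pos n : 0 < n.+2%:R^-1 :> R by rewrite invr_gt0.
have le n : p <= p + n.+2%:R^-1 by rewrite lerDl ltW.
split; [split|].
- by move=> n; exists p, (p + n.+2%:R^-1).
- by move=> n _ /=; rewrite in_itv/= lexx le.
- rewrite /ideal_filter /= [X in ~` X](_ : _ = setT) ?setCT.
    exact: I_ideal.2 (ideal_initial_segment 0).
  apply/seteqP; split => // n _; rewrite /small_indices /=.
  rewrite completed_lebesgue_itv// addrAC subrr add0r !lte_fin pos/=.
  by rewrite ltf_pV2 ?posrE// ltr_nat.
Qed.

Lemma interval_density_one_ideal (E : set R) (x : R) :
  interval_density_one E x -> ideal_density_points I E x.
Proof.
move=> Ex; rewrite /ideal_density_points /lower_ideal_density /=.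
rewrite [X in ereal_inf X](_ : _ = [set 1%E]) ?ereal_inf1//.
suff eq1 J : closed_intervals_about x J -> ideal_filter I (small_indices J) ->
    ideal_liminf I (density_quotient E J) = 1%E.
  apply/seteqP; split => [_ [J [Jx JI] <-]|_ ->]; first exact: eq1.
  have [J [Jx JI]] := closed_intervals_about_small x.
  by exists J => //; exact: eq1.
move=> [Jab Jx] JI; apply: ideal_liminf_eq1 => [n|e e0].
  rewrite /density_quotient; have [a [b [ab ->]]] := Jab n.
  have [/andP[q0 q1] _] := @completed_lebesgue_setI_itv R a b E ab.
  rewrite completed_lebesgue_itv//=.
  (* On a degenerate interval the quotient is 0 by convention, still at most 1. *)
  have [->|ab0] := eqVneq (b - a) 0; first by rewrite invr0 mulr0.
  by rewrite ler_pdivrMr ?mul1r// lt_neqAle eq_sym ab0 subr_ge0.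
have [d d0 Ed] := Ex e e0.
have [N _ Nd] := near_infty_natSinv_lt (PosNum d0).
apply: (I_ideal.2 _ ([set k | (k < N)%N] `|` ~` small_indices J)).
  move=> n qn; have [nN|nN] := ltnP n N; first by left.
  right => Jn; move: qn Jn (Nd n nN) (Jx n Logic.I).
  rewrite /small_indices /density_quotient /=.
  have [a [b [ab ->]]] := Jab n.
  rewrite completed_lebesgue_itv//= !lte_fin in_itv/=.
  move=> + /andP[ab0 abn] nd axb; apply/negP; rewrite -leNgt.
  rewrite ler_pdivlMr// -lee_fin.
  have [_ fin] := @completed_lebesgue_setI_itv R a b E ab.
  by rewrite fineK// Ed// ?(lt_trans abn)// -subr_gt0.
by apply: I_ideal.1 => //; exact: ideal_initial_segment.
Qed.

End ideal_density.

Theorem theorem4p6 (R : realType) (I : set (set nat))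
  (I_ideal : is_ideal I)
  (I_nontrivial : nontrivial_ideal I)
  (I_admissible : admissible_ideal I) :
  <<s @ideal_density_topology R I >> = @lebesgue_measurable R.
Proof.
apply/seteqP; split.
  apply: smallest_sub => [|A [] //].
  split; first exact: measurable0.
  - by move=> A mA; rewrite setTD; exact: measurableC.
  - by move=> F mF; exact: bigcupT_measurable.
move=> E mE; have [Z [mZ Z0 EZ]] := interval_density_ae _ mE.
have mEZ : lebesgue_measurable (E `&` Z) by exact: measurableI.
have EZ0 : completed_lebesgue_measure (E `&` Z) = 0%E.
  apply/eqP; rewrite eq_le completed_lebesgue_ge0 andbT -Z0.
  apply: le_completed_lebesgue; exact: subIsetr.
pose S := g_sigma_algebraType (@ideal_density_topology R I).
have open_mS (A : set R) : lebesgue_measurable A ->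
    (forall x, A x -> interval_density_one A x) -> measurable (A : set S).
  move=> mA Ax; apply: sub_sigma_algebra; split => // x /Ax.
  exact: interval_density_one_ideal.
suff : measurable (E : set S) by [].
(* The double complement exhibits the null part of [E] as the complement of an open set. *)
rewrite -(setDUK (@subIsetl _ E Z)) -(setCK (E `&` Z)).
apply: measurableU.
  apply: measurableC; apply: open_mS; first exact: measurableC.
  move=> x _; rewrite -setTD; apply: interval_density_oneD => //.
  exact: interval_density_one_setT.
rewrite setCK setDIr setDv set0U; apply: open_mS; first exact: measurableD.
exact: EZ.
Qed.
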